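(* Let $\mathcal C$ be a class of coloured digraphs of a fixed signature. If $\underline{\mathcal C}$ is superflat, then $\mathcal C$ is stable.
   Context: A coloured digraph is a relational structure all of whose relation symbols have arity at most $2$. The underlying (Gaifman) graph $\underline M$ of $M$ has vertex set the universe of $M$, with $a,b$ adjacent iff $a\ne b$ and both occur in some tuple of some relation of $M$; $\underline{\mathcal C}=\{\underline M: M\in\mathcal C\}$. $K_m^r$ denotes $K_m$ with each edge subdivided exactly $r$ times; a class of graphs is superflat if for every $r$ there is $m$ such that $K_m^r$ is not a (not necessarily induced) subgraph of any member. A first-order formula $\phi(\bar x,\bar y)$ has the order property with respect to $\mathcal C$ if for every $n$ there exist $M\in\mathcal C$ and tuples $\bar a_0,\dots,\bar a_{n-1},\bar b_0,\dots,\bar b_{n-1}$ in $M$ with $M\models\phi(\bar a_i,\bar b_j)$ iff $i<j$; $\mathcal C$ is stable if no first-order formula (in the signature of $\mathcal C$) has the order property with respect to $\mathcal C$. *)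

(* Defs.v *)
From mathcomp Require Import all_boot.
Set Implicit Arguments.
Unset Strict Implicit.
Unset Printing Implicit Defensive.

(* Signature of coloured digraphs: relation symbols of arity <= 2.      *)
(*   N : nullary symbols, U : unary symbols, B : binary symbols.       *)
Section Sig.
Variables (N U B : Type).

(* A structure (coloured digraph); first-order structures are nonempty. *)
Record cdigraph := CDigraph {
  carrier :> Type;
  carrier_inh : inhabited carrier;
  nrel : N -> Prop;
  urel : U -> carrier -> Prop;
  brel : B -> carrier -> carrier -> Prop
}.

(* Gaifman graph adjacency.  Only binary relations can contain two
   distinct elements in one tuple. *)
Definition gaifman_adj (M : cdigraph) (a b : M) : Prop :=
  a <> b /\ exists e : B, brel e a b \/ brel e b a.

Inductive formula : Type :=
| FEq  of nat & nat
| FNul of N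
| FUn  of U & nat
| FBin of B & nat & nat
| FNot of formula
| FAnd of formula & formula
| FEx  of nat & formula.

Definition upd (M : Type) (e : nat -> M) (x : nat) (a : M) : nat -> M :=
  fun y => if y == x then a else e y.

Fixpoint sat (M : cdigraph) (e : nat -> M) (f : formula) : Prop :=
  match f with
  | FEq x y => e x = e y
  | FNul c => nrel M c
  | FUn p x => urel p (e x)
  | FBin r x y => brel r (e x) (e y)
  | FNot g => ~ sat e g
  | FAnd g h => sat e g /\ sat e h
  | FEx x g => exists a : M, sat (upd e x a) g
  end.

Fixpoint free (v : nat) (f : formula) : bool :=
  match f with
  | FEq x y => (v == x) || (v == y)
  | FNul _ => false
  | FUn _ x => v == x
  | FBin _ x y => (v == x) || (v == y)
  | FNot g => free v g
  | FAnd g h => free v g || free v h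
  | FEx x g => (v != x) && free v g
  end.

(* phi(x_0..x_{k-1}, y_0..y_{l-1}): free variables among 0..k+l-1, the
   x-tuple occupies variables 0..k-1 and the y-tuple variables k..k+l-1. *)
Definition fv_below (n : nat) (f : formula) : Prop :=
  forall v, free v f -> v < n.

Definition order_property (C : cdigraph -> Prop) (k l : nat) (phi : formula) : Prop :=
  forall n : nat, exists (M : cdigraph) (a : 'I_n -> 'I_k -> M) (b : 'I_n -> 'I_l -> M),
    C M /\
    forall (i j : 'I_n) (e : nat -> M),
      (forall v : 'I_k, e v = a i v) ->
      (forall v : 'I_l, e (k + v) = b j v) ->
      (sat e phi <-> i < j).

Definition stable (C : cdigraph -> Prop) : Prop :=
  forall (k l : nat) (phi : formula), fv_below (k + l) phi -> ~ order_property C k l phi.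

End Sig.

(* K_m^r : K_m with every edge subdivided exactly r times.              *)
(* Vertices: branch vertices inl i (i < m) and subdivision vertices     *)
(* inr (i, j, t) for i < j, t < r (the t-th inner vertex on the path    *)
(* from i to j).  inr (i,j,t) with ~~ (i < j) are junk (not vertices).  *)
Definition ksub_vert (m r : nat) := ('I_m + ('I_m * 'I_m * 'I_r))%type.

Definition ksub_valid (m r : nat) (v : ksub_vert m r) : bool :=
  match v with
  | inl _ => true
  | inr (i, j, _) => i < j
  end.

Definition ksub_adj0 (m r : nat) (u v : ksub_vert m r) : bool :=
  match u, v with
  | inl i, inl j => (r == 0) && (i < j)
  | inl i, inr (i', j, t) => (i == i') && (i' < j) && (val t == 0)
  | inr (i, j, t), inr (i', j', t') =>
      [&& i == i', j == j', i < j & (val t).+1 == val t']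
  | inr (i, j, t), inl j' => [&& i < j, j == j' & (val t).+1 == r]
  end.

Definition ksub_adj (m r : nat) (u v : ksub_vert m r) : bool :=
  ksub_adj0 u v || ksub_adj0 v u.

Definition ksub_subgraph (m r : nat) (V : Type) (adj : V -> V -> Prop) : Prop :=
  exists f : ksub_vert m r -> V,
    (forall u v, ksub_valid u -> ksub_valid v -> f u = f v -> u = v) /\
    (forall u v, ksub_valid u -> ksub_valid v -> ksub_adj u v -> adj (f u) (f v)).

Definition gaifman_superflat (N U B : Type) (C : cdigraph N U B -> Prop) : Prop :=
  forall r : nat, exists m : nat,
    forall M, C M -> ~ ksub_subgraph m r (@gaifman_adj N U B M).

(* Main.v *)
From mathcomp Require Import boolp.
Require Import Defs.
From mathcomp Require Import all_boot zify.
Set Implicit Arguments.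
Unset Strict Implicit.
Unset Printing Implicit Defensive.

(** In a superflat class, every long sequence of tuples has a long subsequence
    that becomes pairwise far apart after deleting a bounded set [S] of vertices.
    Otherwise some tuple is near many others; the walks witnessing this contain a
    large fan, whose centre is put into [S].  After sufficiently many rounds the
    centres ("hubs") all have fans to one common large set of targets, and routing
    each pair of hubs through its own target produces a subdivided clique, with
    equally long subdivisions by Ramsey's theorem.

    The truth of a formula at a tuple is determined by a bounded back-and-forth
    type of the tuple: finitely many moves, each at bounded distance, in the graph
    without [S].  There are finitely many such types, so two tuples [a_i b_i] and
    [a_j b_j] of the scattered subsequence share theirs.  As they are far apart,
    the types of [a_i b_j] and [a_j b_i] also agree, against the order property. *)

(** * Combinatorics of finite families *)

Lemma pigeonhole_count (I : eqType) (C : finType) (f : I -> C) (J : seq I) q :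
  #|C| * q < size J -> exists k, q < count (fun j => f j == k) J.
Proof.
move=> sJ; apply/existsP; apply: contraTT sJ; rewrite negb_exists -leqNgt.
move=> /forallP Hq.
have -> : size J = \sum_(k : C) count (fun j => f j == k) J.
  rewrite -sum1_size (partition_big f predT) //=.
  by apply: eq_bigr => k _; rewrite sum1_count.
rewrite -sum_nat_const; apply: leq_sum => k _; by rewrite leqNgt.
Qed.

Lemma count_has_le (I V : eqType) (P : V -> pred I) (s : seq V) (J : seq I) q :
  {in s, forall v, count (P v) J <= q} ->
  count (fun j => has (fun v => P v j) s) J <= size s * q.
Proof.
elim: s => [|v s IH] Hq /=; first by rewrite count_pred0.
apply: (@leq_trans (count (predU (P v) (fun j => has (P^~ j) s)) J)).
  exact: sub_count.
rewrite mulSn; apply: (leq_trans (leq_addr (count (predI (P v) (fun j => has (P^~ j) s)) J) _)).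
rewrite count_predUI leq_add //.
  by apply: Hq; rewrite mem_head.
by apply: IH => w ws; apply: Hq; rewrite inE ws orbT.
Qed.

(** Greedy choice: the first index is kept and its neighbours are dropped from the rest; if that
    leaves too few indices for the next round, the first index itself has more than [q]
    neighbours. *)
Lemma indep_or_degree (I : eqType) (e : rel I) p q (J : seq I) :
  symmetric e -> p * q.+1 <= size J ->
  (exists J', [/\ subseq J' J, size J' = p &
                  {in J' &, forall i j, i != j -> ~~ e i j}]) \/
  (exists2 i, i \in J & q < count (e i) J).
Proof.
move=> e_sym; elim: p J => [|p IH] J.
  by move=> _; left; exists [::]; split=> //; rewrite sub0seq.
case: J => [//|i J]; rewrite mulSn /= addSn ltnS => sJ.
have [big|small] := leqP (p * q.+1) (size [seq j <- J | ~~ e i j]).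
  case: (IH _ big) => [[J' [sJ' szJ' indJ']]|[k kJ dk]].
    left; exists (i :: J'); split=> /=; last 1 first.
    - have iJ' j : j \in J' -> ~~ e i j.
        by move/(mem_subseq sJ'); rewrite mem_filter => /andP[].
      move=> a b; rewrite !inE => /predU1P[->|aJ] /predU1P[->|bJ].
      + by rewrite eqxx.
      + by move=> _; apply: iJ'.
      + by move=> _; rewrite e_sym; apply: iJ'.
      + exact: indJ'.
    - by rewrite eqxx (subseq_trans sJ') // filter_subseq.
    - by rewrite szJ'.
  right; exists k.
    by move: kJ; rewrite mem_filter inE => /andP[_ ->]; rewrite orbT.
  apply: (leq_trans dk); rewrite count_filter /=.
  apply: (@leq_trans (count (e k) J)); last by rewrite leq_addl.
  by apply: sub_count => j /andP[].
right; exists i; first exact: mem_head.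
move: sJ small; rewrite size_filter -(count_predC (e i) J) /=.
have -> : count (predC (e i)) J = count (fun j => ~~ e i j) J by [].
lia.
Qed.

Definition disjoint_on (I V : eqType) (F : I -> seq V) (J : seq I) :=
  {in J &, forall i j, i != j -> ~~ has (mem (F i)) (F j)}.

Lemma disjoint_on_sub (I V : eqType) (F : I -> seq V) (J J' : seq I) :
  {subset J' <= J} -> disjoint_on F J -> disjoint_on F J'.
Proof. by move=> sub dF i j iJ jJ; apply: dF; apply: sub. Qed.

(** Intersection serves as adjacency: a set that meets more than [h * q] of the sets has at most [h]
    elements, so one of these lies in more than [q] sets. *)
Lemma disjoint_or_popular (I V : eqType) (F : I -> seq V) h p q (J : seq I) :
  {in J, forall j, size (F j) <= h} -> p * (h * q).+1 <= size J ->
  (exists J', [/\ subseq J' J, size J' = p & disjoint_on F J']) \/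
  (exists v, q < count (fun j => v \in F j) J).
Proof.
move=> Fh sJ.
have e_sym : symmetric (fun i j => has (mem (F i)) (F j)).
  by move=> i j; rewrite has_sym.
case: (indep_or_degree e_sym sJ) => [|[i iJ di]]; first by left.
right; case: (boolP (has (fun v => q < count (fun j => v \in F j) J) (F i))).
  by case/hasP=> v _ Hv; exists v.
move/hasPn => Hn; exfalso.
have := @count_has_le I V (fun v j => v \in F j) (F i) J q.
have -> : count (fun j => has (fun v => v \in F j) (F i)) J
   = count (fun j => has (mem (F i)) (F j)) J.
  by apply: eq_count => j; rewrite e_sym.
have Hq : {in F i, forall v, count (fun j => v \in F j) J <= q}.
  by move=> v vF; rewrite leqNgt; apply: Hn.
move=> /(_ Hq) H.
by have := leq_trans di (leq_trans H (leq_mul (Fh _ iJ) (leqnn q))); rewrite ltnn.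
Qed.

(** First half of Ramsey's theorem for pairs, where the colour depends on the earlier element alone:
    the head gets a popular colour [k], and the rest is found among the indices joined to it in that
    colour. *)
Lemma prehomogeneous_subseq (C : finType) n :
  exists N, forall (f : nat -> nat -> C) (J : seq nat),
    uniq J -> N <= size J -> exists g J',
      [/\ subseq J' J, size J' = n & pairwise (fun i j => f i j == g i) J'].
Proof.
elim: n => [|n [N IH]].
  by exists 0 => f J _ _; exists (f 0), [::]; split=> //; rewrite sub0seq.
exists (#|C| * N).+2 => f [//|i J] /= /andP[iJ uJ]; rewrite ltnS => sJ.
have [k Hk] := @pigeonhole_count _ _ (f i) _ _ sJ.
have [||g [J' [sJ' szJ' pw]]] := IH f [seq j <- J | f i j == k].
- exact: filter_uniq.
- by rewrite size_filter ltnW.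
have Hi j : j \in J' -> (f i j == k) && (j \in J).
  by move/(mem_subseq sJ'); rewrite mem_filter.
exists (fun a => if a == i then k else g a), (i :: J'); split=> /=.
- by rewrite eqxx (subseq_trans sJ') // filter_subseq.
- by rewrite szJ'.
- rewrite eqxx; apply/andP; split; first by apply/allP => j /Hi /andP[].
  apply: (@sub_in_pairwise _ (mem J') _ _ _ _ (allss J') pw) => a b /Hi /andP[_ aJ] _ fg.
  by have /negbTE -> : a != i by apply: contraNneq iJ => <-.
Qed.

Lemma ramsey_pairs (C : finType) n :
  exists N, forall (f : nat -> nat -> C) (J : seq nat),
    uniq J -> N <= size J -> exists k J',
      [/\ subseq J' J, n <= size J' & pairwise (fun i j => f i j == k) J'].
Proof.
have [N HN] := prehomogeneous_subseq C (#|C| * n).+1.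
exists N => f J uJ sJ.
have [g [J' [sJ' szJ' pw]]] := HN f J uJ sJ.
have [|k Hk] := @pigeonhole_count _ _ g J' n; first by rewrite szJ'.
exists k, [seq j <- J' | g j == k]; split.
- by rewrite (subseq_trans _ sJ') // filter_subseq.
- by rewrite size_filter ltnW.
- apply: (sub_in_pairwise _ (filter_all _ _) (subseq_pairwise (filter_subseq _ _) pw)).
  by move=> a b /eqP <- _.
Qed.

(** * Walks, bounded distance and fans *)

Section Walks.
Variables (V : eqType) (adj : rel V).
Hypothesis adj_sym : symmetric adj.

Lemma rev_walk x p :
  path adj (last x p) (rev (belast x p)) = path adj x p.
Proof. by rewrite rev_path; apply: eq_path => a b; rewrite adj_sym. Qed.

Lemma last_rev_belast x p : last (last x p) (rev (belast x p)) = x :> V.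
Proof. by case: p => //= a p; rewrite rev_cons last_rcons. Qed.

(* Bounded distance in the graph with the vertices of [S] removed; no vertex
   of [S] is near anything, itself included. *)
Definition near_avoid (S : seq V) r x y := exists p,
  [/\ path adj x p, last x p = y, size p <= r & all (fun v => v \notin S) (x :: p)].

Lemma near_avoid_sym S r x y : near_avoid S r x y -> near_avoid S r y x.
Proof.
case=> p [xp <- sp allp]; exists (rev (belast x p)); split.
- by rewrite rev_walk.
- exact: last_rev_belast.
- by rewrite size_rev size_belast.
- apply/allP => v; rewrite inE => H; apply: (allP allp).
  case/predU1P: H => [->|]; first exact: mem_last.
  by rewrite mem_rev => /mem_belast.
Qed.

Lemma near_avoid_trans S a b x y z : near_avoid S a x y -> near_avoid S b y z -> near_avoid S (a + b) x z.
Proof.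
case=> p [xp <- sp allp] [q [yq <- sq allq]]; exists (p ++ q); split.
- by rewrite cat_path xp.
- by rewrite last_cat.
- by rewrite size_cat leq_add.
- by rewrite -cat_cons all_cat allp; case/andP: allq.
Qed.

Lemma near_avoid_mono S a b x y : a <= b -> near_avoid S a x y -> near_avoid S b x y.
Proof. by move=> ab [p [? ? sp ?]]; exists p; split=> //; apply: leq_trans ab. Qed.

(** A walk is stored without its start, so disjointness of the [Q j] still lets all of them leave
    from the common centre [w]. *)
Definition fan r (I : eqType) (y : I -> V) (J : seq I) (w : V) :=
  exists2 Q : I -> seq V,
    {in J, forall j, [/\ path adj w (Q j), last w (Q j) = y j & size (Q j) <= r]} &
    disjoint_on Q J.

Lemma fan_sub r (I : eqType) (y : I -> V) (J J' : seq I) w :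
  {subset J' <= J} -> fan r y J w -> fan r y J' w.
Proof.
move=> sub [Q HQ dQ]; exists Q; first by move=> j /sub; apply: HQ.
exact: disjoint_on_sub dQ.
Qed.

End Walks.

(* If no large subfamily of the walks is disjoint away from [x], then a vertex
   lies on many of them, and the walks can be shortened to start there. *)
Lemma fan_exists h p : exists N, forall (V I : eqType) (adj : rel V) (D : pred V)
    (y : I -> V) (J : seq I) (x : V) (Q : I -> seq V),
  N <= size J -> D x ->
  {in J, forall j, [/\ path adj x (Q j), last x (Q j) = y j, size (Q j) <= h
                     & all D (Q j)]} ->
  exists w J', [/\ subseq J' J, size J' = p, D w & fan adj h y J' w].
Proof.
elim: h => [|h [N IH]].
  exists p => V I adj D y J x Q sJ Dx HQ; exists x, (take p J); split=> //.
  - exact: take_subseq.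
  - exact: size_takel.
  - have Q0 j : j \in take p J -> Q j = [::].
      by move/mem_take/HQ => [_ _ + _]; rewrite leqn0 => /nilP.
    exists Q; first by move=> j /mem_take/HQ[].
    by move=> i j _ /Q0 -> _.
exists (p * (h.+1 * N).+1) => V I adj D y J x Q sJ Dx HQ.
have Qh : {in J, forall j, size (Q j) <= h.+1} by move=> j /HQ[].
case: (disjoint_or_popular Qh sJ) => [[J' [sJ' szJ' dJ']]|[v popv]].
  exists x, J'; split=> //; exists Q => // j /(mem_subseq sJ') /HQ[] //.
have Dv : D v.
  have /hasP[j /HQ[_ _ _ /allP aD] vQ] : has (fun j => v \in Q j) J.
    by rewrite has_count (leq_ltn_trans _ popv).
  exact: aD.
(* The part of the walk behind its first visit to [v]; at least one vertex is cut off, so the length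
   bound drops to [h]. *)
pose Q' j := drop (index v (Q j)).+1 (Q j).
have HQ' : {in [seq j <- J | v \in Q j], forall j,
   [/\ path adj v (Q' j), last v (Q' j) = y j, size (Q' j) <= h & all D (Q' j)]}.
  move=> j; rewrite mem_filter => /andP[vQ /HQ[]]; rewrite /Q'.
  case/path.splitP: vQ => p1 p2; rewrite cat_path last_rcons => /andP[_ pv].
  rewrite last_cat last_rcons => <-; rewrite size_cat size_rcons all_cat => sz /andP[_ a2].
  by split=> //; move: sz; lia.
have [|w [J' [sJ' szJ' Dw [F HF dF]]]] := IH V I adj D y _ v Q' _ Dv HQ'.
  by rewrite size_filter ltnW.
exists w, J'; split=> //; first exact: (subseq_trans sJ' (filter_subseq _ _)).
by exists F => // j /HF[? ? s]; split=> //; apply: leqW.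
Qed.

(** * Scattered tuples in superflat classes *)

(* The removed set [S] consists of the hubs found so far: an index near many
   others in the remaining graph yields a fan, whose centre is a new hub. *)
Lemma scattered_or_hubs n r N K t : exists N0,
  forall (V I : eqType) (adj : rel V) (c : I -> 'I_n -> V) (J : seq I),
  symmetric adj -> N0 <= size J ->
  (exists S J', [/\ size S <= t, subseq J' J, size J' = N &
     {in J' &, forall i j, i != j -> forall p p', ~ near_avoid adj S r (c i p) (c j p')}]) \/
  (exists (hs : seq (V * 'I_n)) J',
     [/\ size hs = t, uniq (unzip1 hs), subseq J' J, size J' = K &
     {in hs, forall h, fan adj r (fun j => c j h.2) J' h.1}]).
Proof.
elim: t K => [|t IH] K.
  exists K => V I adj c J _ sJ; right; exists [::], (take K J); split=> //.
    exact: take_subseq.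
  exact: size_takel.
have [Nf HNf] := fan_exists r K.
have [N0 HN0] := IH (N * (#|{: 'I_n * 'I_n}| * Nf).+1).
exists N0 => V I adj c J adj_sym sJ.
case: (HN0 V I adj c J adj_sym sJ) => [[S [J' [sS ? ? ?]]]|].
  by left; exists S, J'; split=> //; apply: leqW.
case=> hs [J1 [szh uh sJ1 szJ1 fans]].
pose S := unzip1 hs.
pose e i j := `[< exists p p', near_avoid adj S r (c i p) (c j p') >].
have e_sym : symmetric e.
  move=> i j; apply/asboolP/asboolP => -[p [p' H]]; exists p', p;
  exact: near_avoid_sym.
have [|[J' [sJ' szJ' indep]]|[i iJ deg]] := indep_or_degree (J := J1) e_sym (p := N)
    (q := #|{: 'I_n * 'I_n}| * Nf).
- by rewrite szJ1.
- left; exists S, J'; split=> //.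
  + by rewrite size_map szh.
  + exact: (subseq_trans sJ').
  + move=> a b aJ bJ ab p p' H; move: (indep a b aJ bJ ab) => /asboolP; apply.
    by exists p, p'.
have [pp0 _] : exists pp0 : 'I_n * 'I_n, True.
  have /hasP[j _ /asboolP[p [p' _]]] : has (e i) J1.
    by rewrite has_count (leq_ltn_trans _ deg).
  by exists (p, p').
pose P j (o : ('I_n * 'I_n) * seq V) := e i j ->
  [/\ path adj (c i o.1.1) o.2, last (c i o.1.1) o.2 = c j o.1.2,
      size o.2 <= r & all (fun v => v \notin S) (c i o.1.1 :: o.2)].
have /boolp.choice[f Hf] : forall j, exists o, P j o.
  move=> j; case: (boolP (e i j)) => [/asboolP[p [p' [q H]]]|ne].
    by exists ((p, p'), q).
  by exists (pp0, [::]) => /(negP ne).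
rewrite -size_filter in deg.
(* With the pair of coordinates fixed, all walks start at the single vertex [c i p] and end in the
   same coordinate [p']. *)
have [[p p'] Hpp] := @pigeonhole_count _ _ (fun j => (f j).1) _ _ deg.
set J2 := [seq j <- J1 | e i j] in deg Hpp.
pose J3 := [seq j <- J2 | (f j).1 == (p, p')].
have HJ3 j : j \in J3 -> e i j /\ (f j).1 = (p, p').
  by rewrite !mem_filter => /and3P[/eqP -> ->].
have J3gt : Nf < size J3 by rewrite size_filter.
have Dx : c i p \notin S.
  case: (J3) J3gt HJ3 => // j J4 _ /(_ j (mem_head _ _)) [/Hf[_ _ _] + fj].
  by rewrite fj => /andP[].
have [|w [J' [sJ' szJ' Dw fanw]]] := HNf V I adj (fun v => v \notin S)
    (fun j => c j p') J3 (c i p) (fun j => (f j).2) (ltnW J3gt) Dx.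
  by move=> j /HJ3[/Hf[+ + + /andP[_ H]] fj]; rewrite fj.
have sub' : subseq J' J1.
  exact: (subseq_trans sJ' (subseq_trans (filter_subseq _ _) (filter_subseq _ _))).
(* The new centre [w] lies outside [S], hence differs from all earlier hubs, whose fans are
   restricted to [J']. *)
right; exists ((w, p') :: hs), J'; split=> //=.
- by rewrite szh.
- by rewrite Dw.
- exact: (subseq_trans sub').
- move=> h; rewrite inE => /predU1P[->//|hhs].
  by apply: fan_sub (fans h hhs) => j; apply: mem_subseq.
Qed.

(* [P a b] lists the inner vertices of a path from [w a] to [w b]. *)
Lemma ksub_of_connections L m : exists T,
  forall (V : eqType) (adj : rel V) (w : nat -> V) (P : nat -> nat -> seq V),
  symmetric adj ->
  {in gtn T &, injective w} ->
  (forall a b, a < b < T -> [/\ path adj (w a) (rcons (P a b) (w b)),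
     uniq (P a b), size (P a b) <= L & forall c, c < T -> w c \notin P a b]) ->
  (forall a b a' b' v, a < b < T -> a' < b' < T -> v \in P a b -> v \in P a' b' ->
     a = a' /\ b = b') ->
  exists2 r, r <= L & forall m', m' <= m -> ksub_subgraph m' r adj.
Proof.
have [T HT] := ramsey_pairs 'I_L.+1 m.
exists T => V adj w P adj_sym w_inj HP dP.
(* Pairs are coloured by the number of inner vertices of their path; on [J] every path has exactly
   [k]. *)
have [|k [J [sJ szJ pw]]] := HT (fun a b => inord (size (P a b))) (iota 0 T) (iota_uniq _ _).
  by rewrite size_iota.
exists k; first by rewrite -ltnS.
move=> m' m'm; pose a i := nth 0 J i.
have aT (i : 'I_m') : a i < T.
  have : a i \in iota 0 T.
    by apply: (mem_subseq sJ); rewrite mem_nth // (leq_trans (ltn_ord i)) ?(leq_trans m'm).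
  by rewrite mem_iota.
have pJ : pairwise ltn J.
  by apply: (subseq_pairwise sJ); rewrite -sorted_pairwise ?iota_ltn_sorted //; apply: ltn_trans.
have iJ (i : 'I_m') : i < size J by rewrite (leq_trans (ltn_ord i)) ?(leq_trans m'm).
have alt (i j : 'I_m') : i < j -> a i < a j.
  by move=> ij; move/(pairwiseP 0): pJ; apply; rewrite ?inE.
have ainj (i j : 'I_m') : a i = a j -> i = j.
  move=> aij; apply/val_inj => /=; case: (ltngtP i j) => // /alt; rewrite aij ltnn //.
have abT (i j : 'I_m') : i < j -> a i < a j < T by move=> ij; rewrite alt ?aT.
have szP (i j : 'I_m') : i < j -> size (P (a i) (a j)) = k.
  move=> ij; have /eqP <- : inord (size (P (a i) (a j))) == k.
    by move/(pairwiseP 0): pw; apply; rewrite ?inE.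
  by rewrite inordK // ltnS; case: (HP _ _ (abT _ _ ij)).
pose g (v : ksub_vert m' k) := match v with
  | inl i => w (a i)
  | inr (i, j, t) => nth (w 0) (P (a i) (a j)) t end.
have gP (i j : 'I_m') (t : 'I_k) : i < j -> g (inr (i, j, t)) \in P (a i) (a j).
  by move=> ij; rewrite mem_nth // szP.
have g0 (u v : ksub_vert m' k) : ksub_valid u -> ksub_valid v -> ksub_adj0 u v -> adj (g u) (g v).
  (* Every edge of the subdivided clique is the step number [t] of such a path; the four cases below
     differ in the value of [t]. *)
  have pth (i j : 'I_m') : i < j -> forall t, t <= k ->
      adj (nth (w 0) (w (a i) :: rcons (P (a i) (a j)) (w (a j))) t)
          (nth (w 0) (rcons (P (a i) (a j)) (w (a j))) t).
    move=> ij t tk; have [+ _ _ _] := HP _ _ (abT _ _ ij).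
    by move/(pathP (w 0)); apply; rewrite size_rcons szP.
  case: u v => [i|[[i j] t]] [i'|[[i' j'] t']] /=.
  - move=> _ _ /andP[/eqP k0 ij]; have := pth i i' ij 0 (leq0n _).
    by have /nilP -> : nilp (P (a i) (a i')) by rewrite /nilp szP ?k0.
  - move=> _ ij /andP[/andP[/eqP -> _] /eqP t0]; have := pth i' j' ij 0 (leq0n _).
    by rewrite /= nth_rcons szP // -{1}t0 ltn_ord t0.
  - move=> ij _ /and3P[_ /eqP <- /eqP tk]; have := pth i j ij k (leqnn _).
    rewrite [X in adj _ X]nth_rcons szP // ltnn eqxx -[in X in nth _ _ X]tk /=.
    by rewrite nth_rcons szP // ltn_ord.
  - move=> ij _ /and4P[/eqP <- /eqP <- _ /eqP tt]; have := pth i j ij t.+1 (ltn_ord t).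
    by rewrite /= !nth_rcons szP // ltn_ord tt ltn_ord.
exists g; split; last first.
  by move=> u v uv vv /orP[]; [exact: g0 | rewrite adj_sym; exact: g0].
have gw (c i j : 'I_m') (t : 'I_k) : i < j -> g (inl c) <> g (inr (i, j, t)).
  move=> ij E; have [_ _ _ /(_ _ (aT c))] := HP _ _ (abT _ _ ij).
  by rewrite (E : w (a c) = _) gP.
case=> [i|[[i j] t]] [i'|[[i' j'] t']] /=.
- by move=> _ _ E; congr inl; apply: ainj; apply: w_inj; rewrite ?inE //; apply: aT.
- by move=> _ ij /(gw _ _ _ _ ij).
- by move=> ij _ /esym /(gw _ _ _ _ ij).
- move=> ij ij' E.
  have [/ainj Ei /ainj Ej] := dP _ _ _ _ _ (abT _ _ ij) (abT _ _ ij') (gP i j t ij)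
     (eq_ind_r (fun v => v \in _) (gP i' j' t' ij') E).
  subst i' j'; congr inr; congr pair; apply/val_inj/eqP.
  have [_ uP _ _] := HP _ _ (abT _ _ ij).
  rewrite -(nth_uniq (w 0) _ _ uP) ?szP //=; exact/eqP.
Qed.

(** Going along [p] and back along [p'] gives a walk from [w] to [w']; [shortenP] turns it into a
    simple path, from which the end [w'] is split off. *)
Lemma connect_through (V : eqType) (adj : rel V) (w w' y : V) p p' :
  symmetric adj -> w != w' ->
  path adj w p -> last w p = y -> path adj w' p' -> last w' p' = y ->
  exists s, [/\ path adj w (rcons s w'), uniq s, size s <= size p + size p'
              & {subset s <= p ++ p'}].
Proof.
move=> adj_sym ww' pw lw pw' lw'; pose q := p ++ rev (belast w' p').
have pq : path adj w q by rewrite cat_path pw lw -lw' rev_walk.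
have lq : last w q = w' by rewrite last_cat lw -lw' last_rev_belast.
case/shortenP: pq lq => q' pq' uq' sub lq'.
case/lastP: q' => [|s z] in pq' uq' sub lq' *.
  by move: ww'; rewrite -lq' eqxx.
rewrite last_rcons in lq'; subst z; exists s; split=> //.
- by move: uq'; rewrite /= rcons_uniq => /and3P[].
- have := uniq_leq_size (proj2 (andP uq')) sub.
  by rewrite size_rcons size_cat size_rev size_belast; lia.
- move=> v vs; have : v \in q by apply: sub; rewrite mem_rcons inE vs orbT.
  rewrite !mem_cat mem_rev => /orP[->//|/mem_belast]; rewrite inE => /predU1P[E|->].
    by move: uq'; rewrite /= rcons_uniq -E vs /= andbF.
  by rewrite orbT.
Qed.

Lemma count_le1 (I : eqType) (P : pred I) (J : seq I) :
  uniq J -> {in J &, forall i j, P i -> P j -> i = j} -> count P J <= 1.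
Proof.
move=> uJ HP; rewrite -size_filter.
have := filter_uniq P uJ; case E: [seq j <- J | P j] => [|i [|j s]] //=.
have /andP[Pi iJ] : (P i) && (i \in J) by rewrite -mem_filter E mem_head.
have /andP[Pj jJ] : (P j) && (j \in J) by rewrite -mem_filter E !inE eqxx orbT.
by rewrite (HP i j) // mem_head.
Qed.

Lemma disjoint_on_count (I V : eqType) (F : I -> seq V) (J : seq I) v :
  uniq J -> disjoint_on F J -> count (fun j => v \in F j) J <= 1.
Proof.
move=> uJ dF; apply: count_le1 => // i j iJ jJ vi vj; apply/eqP.
by apply: contraT => /(dF i j iJ jJ) /hasPn /(_ v vj); rewrite /= vi.
Qed.

(** Each pair of hubs is routed through a target of its own. Within one fan a vertex lies on at most
    one walk, so it meets the walks to at most [T] targets; hence many targets have pairwise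
    disjoint bundles of walks. *)
Lemma ksub_of_hubs r m : exists T K,
  forall (V I : eqType) (adj : rel V) (y : I -> V) (J : seq I) (ws : seq V),
  symmetric adj -> uniq J -> K < size J -> uniq ws -> T < size ws ->
  {in ws, forall w, fan adj r y J w} ->
  exists2 r', r' <= r + r & forall m', m' <= m -> ksub_subgraph m' r' adj.
Proof.
have [T HT] := ksub_of_connections (r + r) m.
(* [T * T] targets serve the pairs and [T] more may be lost to hubs lying on walks; the factor comes
   from [disjoint_or_popular] with [h = T * r] and [q = T]. *)
exists T, ((T * T + T) * (T * r * T).+1) => V I adj y J ws0 adj_sym uJ sJ uws0 sws fans0.
have [i0 _] : exists i : I, True by case: J sJ {uJ fans0} => // i; exists i.
have [v0 _] : exists v : V, True by case: ws0 sws {uws0 fans0} => // v; exists v.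
pose ws := take T ws0.
have uws : uniq ws by rewrite take_uniq.
have szws : size ws = T by rewrite size_takel // ltnW.
pose good w (Q : I -> seq V) := w \in ws ->
  {in J, forall j, [/\ path adj w (Q j), last w (Q j) = y j & size (Q j) <= r]} /\
  disjoint_on Q J.
have /boolp.choice[Q HQ] : forall w, exists Q, good w Q.
  move=> w; case: (boolP (w \in ws)) => [wws|ne]; last by exists (fun _ => [::]) => /(negP ne).
  by have [Q] := fans0 w (mem_take wws); exists Q.
pose F j := flatten [seq Q w j | w <- ws].
have QF w j : w \in ws -> {subset Q w j <= F j}.
  by move=> wws v vQ; apply/flattenP; exists (Q w j) => //; apply: map_f.
have inF v j : (v \in F j) = has (fun w => v \in Q w j) ws.
  by rewrite /F; elim: (ws) => //= w s IH; rewrite mem_cat IH.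
have szF : {in J, forall j, size (F j) <= T * r}.
  move=> j jJ; rewrite /F -szws.
  have : {subset ws <= ws} by [].
  elim: {1 3 4}ws => //= w s IH sub; rewrite size_cat mulSn leq_add //.
    by have [/(_ j jJ)[]] := HQ w (sub w (mem_head _ _)).
  by apply: IH => x xs; apply: sub; rewrite inE xs orbT.
case: (disjoint_or_popular szF (ltnW sJ)) => [[J1 [sJ1 szJ1 dJ1]]|[v]]; last first.
  have -> : count (fun j => v \in F j) J = count (fun j => has (fun w => v \in Q w j) ws) J.
    exact: eq_count.
  have := @count_has_le I V (fun w j => v \in Q w j) ws J 1.
  rewrite szws muln1 => H1 H2; exfalso; move: H2; rewrite ltnNge H1 //.
  by move=> w /HQ[_ dQ]; apply: disjoint_on_count.
have uJ1 := subseq_uniq sJ1 uJ.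
(* Targets whose bundle contains a hub are discarded, since a connecting path must avoid all
   hubs. *)
pose J2 := [seq j <- J1 | ~~ has (fun w => w \in F j) ws].
have szJ2 : T * T <= size J2.
  have := @count_has_le I V (fun w j => w \in F j) ws J1 1.
  rewrite szws muln1 => H.
  have {}H : count (fun j => has (fun w => w \in F j) ws) J1 <= T.
    by apply: H => w _; apply: disjoint_on_count.
  have := count_predC (fun j => has (fun w => w \in F j) ws) J1.
  rewrite size_filter szJ1 /predC /= => E.
  by rewrite -(leq_add2l T) (leq_trans _ (leq_add H (leqnn _))) // E addnC.
have uJ2 : uniq J2 by rewrite filter_uniq.
have HJ2 j : j \in J2 -> (~~ has (fun w => w \in F j) ws) && (j \in J1).
  by rewrite mem_filter.
pose w a := nth v0 ws a.
pose jj a b := nth i0 J2 (a * T + b).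
have idx a b : a < b < T -> a * T + b < size J2.
  by move=> /andP[ab bT]; apply: leq_trans szJ2; nia.
have jjJ a b : a < b < T -> jj a b \in J2 by move=> /idx; apply: mem_nth.
have jj_inj a b a' b' : a < b < T -> a' < b' < T -> jj a b = jj a' b' -> a = a' /\ b = b'.
  move=> H H' /eqP; rewrite nth_uniq ?idx // => /eqP; move: H H' => /andP[ab bT] /andP[ab' bT'].
  move=> E; have Ea : a = a'.
    have := congr1 (fun x => x %/ T) E.
    by rewrite !divnMDl ?(leq_ltn_trans _ bT) // !divn_small ?addn0.
  by subst a'; split=> //; move/addnI: E.
have wws a : a < T -> w a \in ws by move=> aT; rewrite mem_nth // szws.
have w_inj : {in gtn T &, injective w}.
  by move=> a b aT bT /eqP; rewrite nth_uniq ?szws // => /eqP.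
pose conn (ab : nat * nat) s := ab.1 < ab.2 < T ->
  [/\ path adj (w ab.1) (rcons s (w ab.2)), uniq s, size s <= r + r
    & {subset s <= F (jj ab.1 ab.2)}].
have /boolp.choice[P HP] : forall ab, exists s, conn ab s.
  case=> a b; case: (boolP (a < b < T)) => [H|ne]; last first.
    by exists [::]; rewrite /conn /= (negbTE ne).
  have /andP[ab bT] := H; have aT := ltn_trans ab bT.
  have jJ : jj a b \in J by apply: (mem_subseq sJ1); have /andP[] := HJ2 _ (jjJ _ _ H).
  have [/(_ _ jJ)[pa la sa] _] := HQ _ (wws a aT).
  have [/(_ _ jJ)[pb lb sb] _] := HQ _ (wws b bT).
  have ne : w a != w b by apply/eqP => /w_inj E; move: ab; rewrite E ?ltnn ?inE.
  have [s [ps us ss sub]] := connect_through adj_sym ne pa la pb lb.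
  exists s => _; split=> //=; first exact: (leq_trans ss (leq_add sa sb)).
  by move=> v /sub; rewrite mem_cat => /orP[]; apply: QF; apply: wws.
apply: (HT V adj w (fun a b => P (a, b))) => //.
  move=> a b ab; have [pP uP sP sub] := HP (a, b) ab; split=> // c cT.
  have /andP[/hasPn Hn _] := HJ2 _ (jjJ _ _ ab).
  by apply: contra (Hn _ (wws c cT)) => /sub.
move=> a b a' b' v ab ab' vP vP'.
have [_ _ _ /(_ v vP) vF] := HP (a, b) ab.
have [_ _ _ /(_ v vP') vF'] := HP (a', b') ab'.
apply: jj_inj => //; apply/eqP; apply: contraT => ne.
have /andP[_ j1] := HJ2 _ (jjJ _ _ ab); have /andP[_ j2] := HJ2 _ (jjJ _ _ ab').
by have /hasPn /(_ v vF') := dJ1 _ _ j1 j2 ne; rewrite /= vF.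
Qed.

(** * Gaifman graphs of superflat classes *)

Definition gaifman_rel (N U B : Type) (M : cdigraph N U B) : rel {classic M} :=
  fun a b => `[< gaifman_adj a b >].

Lemma gaifman_rel_sym (N U B : Type) (M : cdigraph N U B) : symmetric (@gaifman_rel N U B M).
Proof.
move=> a b; apply/asboolP/asboolP => -[ne [e He]]; split; try exact: nesym.
- by exists e; case: He; [right | left].
- by exists e; case: He; [right | left].
Qed.

(** Too many hubs would produce a forbidden subdivided clique. The bound [t] on the deleted set is
    fixed before [p], so that [p] may later depend on [t]. *)
Lemma superflat_scattered (N U B : Type) (C : cdigraph N U B -> Prop) n r :
  gaifman_superflat C -> exists t, forall p, exists N0,
  forall M, C M -> forall c : 'I_N0 -> 'I_n -> {classic M},
  exists (S : seq {classic M}) (J : seq 'I_N0), [/\ size S <= t, uniq J, size J = p &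
    {in J &, forall i j, i != j -> forall k k',
       ~ near_avoid (@gaifman_rel N U B M) S r (c i k) (c j k')}].
Proof.
move=> /boolp.choice[ms Hms].
(* The subdivision length [r'] is only known to be at most [r + r]; the maximum covers whichever
   length occurs. *)
have [T [K HTK]] := ksub_of_hubs r (\max_(r' < (r + r).+1) ms r').
exists (n * T).+1 => p; have [N0 HN0] := scattered_or_hubs n r p K.+1 (n * T).+1.
exists N0 => M CM c.
have [|[S [J [sS sJ szJ far]]]|[hs [J [szh uh sJ szJ fans]]]] :=
  HN0 _ _ _ c (enum 'I_N0) (@gaifman_rel_sym _ _ _ M).
- by rewrite size_enum_ord.
- by exists S, J; split=> //; apply: (subseq_uniq sJ); apply: enum_uniq.
have [|k Hk] := @pigeonhole_count _ _ (fun h => h.2) hs T; first by rewrite card_ord szh.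
pose ws := unzip1 [seq h <- hs | h.2 == k].
have [|||||r' r'r Hm] := HTK _ _ _ (c^~ k) J ws (@gaifman_rel_sym _ _ _ M).
- by apply: (subseq_uniq sJ); apply: enum_uniq.
- by rewrite szJ.
- by apply: (subseq_uniq _ uh); apply: map_subseq; apply: filter_subseq.
- by rewrite size_map size_filter.
- by move=> w /mapP[h]; rewrite mem_filter => /andP[/eqP <- hhs ->]; apply: fans.
exfalso; apply: (Hms r' M CM).
have [|f [finj fadj]] := Hm (ms r').
  by have := @leq_bigmax _ (fun r' : 'I_(r + r).+1 => ms r') (Ordinal (r'r : r' < (r + r).+1)).
by exists f; split=> // u v uu vv uv; apply/asboolP; apply: fadj.
Qed.

(** * Bounded back-and-forth types *)

Definition ext (M I : Type) (u : I -> M) (z : M) (o : option I) : M :=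
  if o is Some i then u i else z.

Definition join (M I J : Type) (u : I -> M) (v : J -> M) (o : I + J) : M :=
  match o with inl i => u i | inr j => v j end.

Section Locality.
Variables (N U B : Type) (KU KB : finType) (us : KU -> U) (bs : KB -> B).

(** Bound variables must lie below [n] as well, so that a quantifier overwrites one entry of an
    [n]-tuple; [us] and [bs] list the finitely many symbols allowed. *)
Fixpoint over (n : nat) (f : formula N U B) : Prop :=
  match f with
  | FEq x y => x < n /\ y < n
  | FNul _ => True
  | FUn p x => (exists k, us k = p) /\ x < n
  | FBin r x y => [/\ exists k, bs k = r, x < n & y < n]
  | FNot g => over n g
  | FAnd g h => over n g /\ over n h
  | FEx x g => x < n /\ over n g
  end.

Section Structure.
Variables (M : cdigraph N U B) (KS : finType) (S : KS -> M).
(** An abstract distance at most [r] after deleting [S]. Reflexivity and the edge axiom are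
    restricted to points outside [S], since in the intended case a deleted vertex is near
    nothing. *)
Variable near : nat -> M -> M -> Prop.
Hypothesis near_sym : forall r x y, near r x y -> near r y x.
Hypothesis near_trans :
  forall a b x y z, near a x y -> near b y z -> near (a + b) x z.
Hypothesis near_mono : forall a b x y, a <= b -> near a x y -> near b x y.
Hypothesis near_refl : forall x, (forall k, x <> S k) -> near 0 x x.
Hypothesis near_brel : forall e x y, brel (bs e) x y ->
  (forall k, x <> S k) -> (forall k, y <> S k) -> near 1 x y.

(** Distances up to [R] count as atoms, so that the reply to a legal move is again a legal move. *)
Definition bin R (b : (option KB + 'I_R.+1)%type) (x y : M) : Prop :=
  match b with
  | inl None => x = y
  | inl (Some e) => brel (bs e) x y
  | inr d => near d x y
  end.

(** The points of [S] act as constants, which keeps track of the relations lost by deleting them. *)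
Definition atom_eq R (I : Type) (u v : I -> M) : Prop :=
  (forall i p, urel (us p) (u i) <-> urel (us p) (v i)) /\
  (forall (b : option KB + 'I_R.+1) i j,
     bin b (join u S i) (join u S j) <-> bin b (join v S i) (join v S j)).

(* Back-and-forth equivalence with [m] moves, where each move is played at
   distance at most [R] from the current tuple. *)
Fixpoint loc R m (I : Type) (u v : I -> M) : Prop :=
  atom_eq R u v /\
  if m is m'.+1 then
    (forall i z, near R (u i) z -> exists z', loc R m' (ext u z) (ext v z')) /\
    (forall i z', near R (v i) z' -> exists z, loc R m' (ext u z) (ext v z'))
  else True.

Lemma loc_atom R m I (u v : I -> M) : loc R m u v -> atom_eq R u v.
Proof. by case: m => [|m] []. Qed.

Lemma loc_near R m I (u v : I -> M) i j d : loc R m u v -> d <= R ->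
  near d (u i) (u j) <-> near d (v i) (v j).
Proof.
move=> /loc_atom[_ H]; rewrite -ltnS => dR.
exact: (H (inr (Ordinal dR)) (inl i) (inl j)).
Qed.

Lemma loc_sym R m I (u v : I -> M) : loc R m u v -> loc R m v u.
Proof.
elim: m I u v => [|m IH] I u v [[H1 H2] H3]; (split; first by split; intros; symmetry);
  first by [].
case: H3 => F G; split=> i z Hz.
- by have [z' /IH Hz'] := G i z Hz; exists z'.
- by have [z' /IH Hz'] := F i z Hz; exists z'.
Qed.

Lemma loc_trans R m I (u v w : I -> M) : loc R m u v -> loc R m v w -> loc R m u w.
Proof.
elim: m I u v w => [|m IH] I u v w H H'.
  case: H H' => [[H1 H2] _] [[H1' H2'] _]; split=> //; split.
    by move=> i p; rewrite H1 H1'.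
  by move=> b i j; rewrite H2 H2'.
case: H H' => [[H1 H2] [F G]] [[H1' H2'] [F' G']]; split; split.
- by move=> i p; rewrite H1 H1'.
- by move=> b i j; rewrite H2 H2'.
- move=> i z Hz; have [z' Hz'] := F i z Hz.
  have [|z'' Hz''] := F' i z'.
    by have := loc_near (Some i) None Hz' (leqnn R); rewrite /= => <-.
  by exists z''; apply: IH Hz' Hz''.
- move=> i z Hz; have [z' Hz'] := G' i z Hz.
  have [|z'' Hz''] := G i z'.
    by have := loc_near (Some i) None Hz' (leqnn R); rewrite /= => ->.
  by exists z''; apply: IH Hz'' Hz'.
Qed.

Lemma loc_reindex R m I J (f : J -> I) (u v : I -> M) :
  loc R m u v -> loc R m (u \o f) (v \o f).
Proof.
have fS (w : I -> M) o : join (w \o f) S o = join w S (match o with inl j => inl (f j) | inr k => inr k end).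
  by case: o.
have fE I' J' (g : J' -> I') (w : I' -> M) z : ext (w \o g) z = ext w z \o option_map g.
  by apply: funext => -[].
elim: m I J f u v fS => [|m IH] I J f u v fS [[H1 H2] H3]; (split; first by
  split; [move=> j p; apply: H1 | move=> b i j; rewrite !fS; apply: H2]); first by [].
have IH' z z' : loc R m (ext u z) (ext v z') -> loc R m (ext (u \o f) z) (ext (v \o f) z').
  by rewrite (fE _ _ f u) (fE _ _ f v); apply: IH => w -[].
case: H3 => F G; split=> i z Hz.
- by have [z' Hz'] := F (f i) z Hz; exists z'; apply: IH'.
- by have [z' Hz'] := G (f i) z Hz; exists z'; apply: IH'.
Qed.

Lemma loc_mono R R' m m' I (u v : I -> M) : R' <= R -> m' <= m ->
  loc R m u v -> loc R' m' u v.
Proof.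
move=> RR; elim: m' m I u v => [|m' IH] m I u v mm H.
all: have aE : atom_eq R' u v.
1,3: case/loc_atom: H => [H1 H2]; split=> // -[b|d] i j; first exact: (H2 (inl b));
  exact: (H2 (inr (widen_ord (RR : R'.+1 <= R.+1) d))).
- by [].
- case: m mm H => // m mm [_ [F G]]; split=> //; split=> i z Hz.
  + have [z' Hz'] := F i z (near_mono RR Hz); exists z'; exact: (IH m).
  + have [z' Hz'] := G i z (near_mono RR Hz); exists z'; exact: (IH m).
Qed.

(* An atom between far apart elements can only hold through [S], and membership
   in [S] is part of the atomic type of each side. *)
Lemma atom_eq_join R I J (u v : I -> M) (u' v' : J -> M) : 0 < R ->
  atom_eq R u v -> atom_eq R u' v' ->
  (forall i j, ~ near R (u i) (u' j)) -> (forall i j, ~ near R (v i) (v' j)) ->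
  atom_eq R (join u u') (join v v').
Proof.
move=> R0 [H1 H2] [H1' H2'] far far'; split; first by case=> ? p; [apply: H1 | apply: H1'].
have bin_near (b : option KB + 'I_R.+1) x y : bin b x y ->
    (forall k, x <> S k) -> (forall k, y <> S k) -> near R x y.
  case: b => [[e|]|d] /=.
  - by move=> H xS yS; apply: near_mono R0 _; apply: near_brel H xS yS.
  - by move=> -> yS _; apply: near_mono (leq0n R) (near_refl yS).
  - by move=> H _ _; apply: near_mono H; rewrite -ltnS.
have cross (b : option KB + 'I_R.+1) i j : (bin b (u i) (u' j) <-> bin b (v i) (v' j)) /\
                   (bin b (u' j) (u i) <-> bin b (v' j) (v i)).
  case: (pselect (exists k, u i = S k)) => [[k uk]|uk].
    have vk : v i = S k by exact/(H2 (inl None) (inl i) (inr k)).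
    by rewrite uk vk; split; [exact: (H2' b (inr k) (inl j)) | exact: (H2' b (inl j) (inr k))].
  case: (pselect (exists k, u' j = S k)) => [[k uk']|uk'].
    have vk' : v' j = S k by exact/(H2' (inl None) (inl j) (inr k)).
    by rewrite uk' vk'; split; [exact: (H2 b (inl i) (inr k)) | exact: (H2 b (inr k) (inl i))].
  have ui k : u i <> S k by move=> E; apply: uk; exists k.
  have uj k : u' j <> S k by move=> E; apply: uk'; exists k.
  have vi k : v i <> S k by move=> /(H2 (inl None) (inl i) (inr k)); apply: ui.
  have vj k : v' j <> S k by move=> /(H2' (inl None) (inl j) (inr k)); apply: uj.
  split; split=> /bin_near H; exfalso.
  - exact: (far i j (H ui uj)).
  - exact: (far' i j (H vi vj)).
  - exact: (far i j (near_sym (H uj ui))).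
  - exact: (far' i j (near_sym (H vj vi))).
move=> b [[i|i]|k] [[j|j]|k'] /=.
- exact: (H2 b (inl i) (inl j)).
- by have [] := cross b i j.
- exact: (H2 b (inl i) (inr k')).
- by have [] := cross b j i.
- exact: (H2' b (inl i) (inl j)).
- exact: (H2' b (inl i) (inr k')).
- exact: (H2 b (inr k) (inl j)).
- exact: (H2' b (inr k) (inl j)).
- by [].
Qed.

Definition option_suml I J (o : option (I + J)) : option I + J :=
  match o with
  | None => inl None | Some (inl i) => inl (Some i) | Some (inr j) => inr j
  end.

Definition option_sumr I J (o : option (I + J)) : I + option J :=
  match o with
  | None => inr None | Some (inl i) => inl i | Some (inr j) => inr (Some j)
  end.

(** A move near one tuple is answered on that side alone. It costs at most [R] of the separation, so
    after [m] moves the two sides are still not within [R] of each other, and [atom_eq_join]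
    applies. *)
Lemma loc_join R m I J (u v : I -> M) (u' v' : J -> M) : 0 < R ->
  loc R m u v -> loc R m u' v' ->
  (forall i j, ~ near (m.+1 * R) (u i) (u' j)) ->
  (forall i j, ~ near (m.+1 * R) (v i) (v' j)) ->
  loc R m (join u u') (join v v').
Proof.
move=> R0; elim: m I J u v u' v' => [|m IH] I J u v u' v' H H' far far'.
  split=> //; rewrite mul1n in far far'.
  exact: atom_eq_join (loc_atom H) (loc_atom H') far far'.
have farR (I' J' : Type) k (a : I' -> M) (b : J' -> M) : (forall i j, ~ near (k.+1 * R) (a i) (b j)) ->
    forall i j, ~ near R (a i) (b j).
  by move=> Hf i j Hn; apply: (Hf i j); apply: near_mono Hn; rewrite leq_pmull.
have farl (I' J' : Type) (a : I' -> M) (b : J' -> M) i z :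
   (forall i j, ~ near (m.+2 * R) (a i) (b j)) -> near R (a i) z ->
   forall i j, ~ near (m.+1 * R) (ext a z i) (b j).
  move=> Hf Hz [i'|] j /= Hn.
    by apply: (Hf i' j); apply: near_mono Hn; rewrite leq_mul2r leqnSn orbT.
  by apply: (Hf i j); rewrite mulSn; apply: near_trans Hn.
have farr (I' J' : Type) (a : I' -> M) (b : J' -> M) j z :
   (forall i j, ~ near (m.+2 * R) (a i) (b j)) -> near R (b j) z ->
   forall i j, ~ near (m.+1 * R) (a i) (ext b z j).
  move=> Hf Hz i j' /near_sym; apply: (farl _ _ b a j z) => //.
  by move=> ? ? /near_sym; apply: Hf.
have El (a : I -> M) (b : J -> M) z : ext (join a b) z = join (ext a z) b \o @option_suml I J.
  by apply: funext => -[[]|].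
have Er (a : I -> M) (b : J -> M) z : ext (join a b) z = join a (ext b z) \o @option_sumr I J.
  by apply: funext => -[[]|].
have nearE (K : Type) (a b : K -> M) k z z' : loc R m (ext a z) (ext b z') ->
    near R (a k) z <-> near R (b k) z'.
  by move=> Hz; have := loc_near (Some k) None Hz (leqnn R).
have left i z z' : near R (u i) z -> loc R m (ext u z) (ext v z') ->
    loc R m (ext (join u u') z) (ext (join v v') z').
  move=> Hz Hzz; rewrite !El; apply: loc_reindex; apply: IH => //.
  - exact: loc_mono (leqnSn m) H'.
  - exact: farl far Hz.
  - exact: farl far' (proj1 (nearE _ _ _ i _ _ Hzz) Hz).
have right j z z' : near R (u' j) z -> loc R m (ext u' z) (ext v' z') ->
    loc R m (ext (join u u') z) (ext (join v v') z').
  move=> Hz Hzz; rewrite !Er; apply: loc_reindex; apply: IH => //.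
  - exact: loc_mono (leqnSn m) H.
  - exact: farr far Hz.
  - exact: farr far' (proj1 (nearE _ _ _ j _ _ Hzz) Hz).
split; first exact: atom_eq_join (loc_atom H) (loc_atom H') (farR _ _ _ _ _ far) (farR _ _ _ _ _ far').
case: H => _ [F G]; case: H' => _ [F' G']; split=> -[i|j] z /= Hz.
- by have [z' Hz'] := F i z Hz; exists z'; exact: left Hz Hz'.
- by have [z' Hz'] := F' j z Hz; exists z'; exact: right Hz Hz'.
- have [z' Hz'] := G i z Hz; exists z'; exact: left (proj2 (nearE _ _ _ i _ _ Hz') Hz) Hz'.
- have [z' Hz'] := G' j z Hz; exists z'; exact: right (proj2 (nearE _ _ _ j _ _ Hz') Hz) Hz'.
Qed.

(** The points [y a] are played one by one on the side of [v], each legal because of an original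
    entry of [v]; this uses up [k] moves. *)
Lemma loc_extend_many R m k I (u v : I -> M) (y : 'I_k -> M) :
  loc R (m + k) u v -> (forall a, exists i, near R (v i) (y a)) ->
  exists x : 'I_k -> M, loc R m (join u x) (join v y).
Proof.
elim: k I u v y => [|k IH] I u v y.
  rewrite addn0 => H _; have f (a : 'I_0) : I by case: a.
  exists y; have E (w : I -> M) : join w y = w \o (fun o => match o with inl i => i | inr a => f a end).
    by apply: funext => -[//|a]; case: (a).
  by rewrite !E; apply: loc_reindex.
rewrite addnS => -[_ [_ G]] Hy; have [i0 Hi0] := Hy ord0.
have [x0 Hx0] := G i0 _ Hi0.
have [|x Hx] := IH _ _ _ (fun a => y (lift ord0 a)) Hx0.
  by move=> a; have [i Hi] := Hy (lift ord0 a); exists (Some i).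
pose g (o : I + 'I_k.+1) : option I + 'I_k := match o with
  | inl i => inl (Some i)
  | inr a => if unlift ord0 a is Some b then inr b else inl None end.
exists (fun a => if unlift ord0 a is Some b then x b else x0).
have -> : join u (fun a => if unlift ord0 a is Some b then x b else x0) = join (ext u x0) x \o g.
  by apply: funext => -[//|a] /=; case: unliftP.
have -> : join v y = join (ext v (y ord0)) (fun a => y (lift ord0 a)) \o g.
  by apply: funext => -[//|a] /=; case: unliftP => [b|] ->.
exact: loc_reindex.
Qed.

(* Suppose a point [z] far from [u] has no counterpart far from [v].  Given [k]
   pairwise distant points near [u] that look like [z], adding [z] gives [k + 1]
   such points in the structure; by assumption they all lie near [v], and they can
   be moved back to the vicinity of [u].  This is absurd for [k > #|I|]. *)
Lemma loc_forth R m (I : finType) (u v : I -> M) z : 0 < R ->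
  loc (3 * (m.+1 * R)) (m + #|I|.+1) u v -> exists z', loc R m (ext u z) (ext v z').
Proof.
move=> R0 H; set D := m.+1 * R in H *.
have RD : R <= D by rewrite leq_pmull.
have D3 : D <= 3 * D by rewrite leq_pmull.
case: (pselect (exists i, near (3 * D) (u i) z)) => [[i Hi]|far].
  move: H; rewrite addnS => -[_ [F _]]; have [z' Hz'] := F i z Hi.
  by exists z'; apply: loc_mono Hz'; [apply: leq_trans D3 | apply: leq_addr].
pose tau z' := loc R m (fun _ : unit => z) (fun _ : unit => z').
have [[z' [tz' farz']]|near_v] := pselect (exists z', tau z' /\ forall i, ~ near D (v i) z').
  exists z'; pose f (o : option I) : I + unit := if o is Some i then inl i else inr tt.
  have E (w : I -> M) a : ext w a = join w (fun _ => a) \o f by apply: funext => -[].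
  rewrite !E; apply: loc_reindex; apply: loc_join => //.
  - by apply: loc_mono H; [apply: leq_trans D3 | apply: leq_addr].
  - by move=> i _ Hn; apply: far; exists i; apply: near_mono Hn.
exfalso.
have Hv z' : tau z' -> exists i, near D (v i) z'.
  move=> tz'; have [//|Hn] := pselect (exists i, near D (v i) z').
  by case: near_v; exists z'; split=> // i Hi; apply: Hn; exists i.
have tau_z : tau z.
  rewrite /tau; move: {1 2}(fun _ : unit => z) => w.
  elim: (m) (unit) w => [|k IH] J w.
    by split.
  by split=> //; split=> j a Ha; exists a; apply: IH.
have scat k : k <= #|I|.+1 -> exists x : 'I_k -> M,
  [/\ forall a, tau (x a), forall a, exists i, near D (u i) (x a)
    & forall a b, a != b -> ~ near (2 * D) (x a) (x b)].
  elim: k => [_|k IH kI].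
    have f (a : 'I_0) : M by case: a.
    by exists f; split=> -[].
  have [x [tx ux dx]] := IH (ltnW kI).
  (* [x a] is within [D] of [u] while [z] is not within [3 * D], which keeps the two more than
     [2 * D] apart. *)
  have xz a : ~ near (2 * D) (x a) z.
    move=> Hn; have [i Hi] := ux a; apply: far; exists i.
    by have := near_trans Hi Hn; rewrite -mulSn.
  pose y (a : 'I_k.+1) := if unlift ord0 a is Some b then x b else z.
  have ty a : tau (y a) by rewrite /y; case: unliftP.
  have dy a b : a != b -> ~ near (2 * D) (y a) (y b).
    rewrite /y; case: unliftP => [a'|] ->; case: unliftP => [b'|] ->.
    - by rewrite (inj_eq lift_inj); apply: dx.
    - by move=> _; apply: xz.
    - by move=> _ /near_sym; apply: xz.
    - by rewrite eqxx.
  (* All [k.+1] points lie within [D] of [v]; their replies keep the type, the separation and the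
     distance at most [D], now from [u]. *)
  have [||x' Hx'] := @loc_extend_many (3 * D) m k.+1 I u v y.
  - by apply: loc_mono H => //; rewrite leq_add2l.
  - by move=> a; have [i Hi] := Hv _ (ty a); exists i; apply: near_mono Hi.
  exists x'; split.
  - move=> a; apply: (loc_trans (ty a)); apply: loc_sym.
    have := loc_reindex (fun _ : unit => inr a) Hx'.
    exact: loc_mono (leq_trans RD D3) (leqnn m).
  - move=> a; have [i Hi] := Hv _ (ty a); exists i.
    exact/(loc_near (inl i) (inr a) Hx' D3).
  - move=> a b ab; have D2 : 2 * D <= 3 * D by rewrite leq_mul2r orbT.
    by move/(loc_near (inr a) (inr b) Hx' D2); apply: dy.
(* Two of the [#|I|.+1] points are within [D] of the same [u i], hence within [2 * D] of each
   other. *)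
have [x [_ ux dx]] := scat _ (leqnn _).
have /boolp.choice[f Hf] := ux.
have [a [b [ab fab]]] : exists a b : 'I_#|I|.+1, a != b /\ f a = f b.
  have /injectivePn[a [b ab fab]] : ~~ injectiveb f.
    apply/negP => /injectiveP /leq_card; rewrite card_ord ltnn //.
  by exists a, b.
apply: (dx a b ab); rewrite mul2n -addnn; apply: near_trans (Hf b).
by apply: near_sym; rewrite -fab; apply: Hf.
Qed.

(** A radius and a number of moves; the existential case is what [loc_forth] asks for with tuples
    indexed by ['I_n]. *)
Fixpoint locality_param (n : nat) (f : formula N U B) : nat * nat :=
  match f with
  | FEq _ _ | FNul _ | FUn _ _ | FBin _ _ _ => (1, 0)
  | FNot g => locality_param n g
  | FAnd g h => (maxn (locality_param n g).1 (locality_param n h).1,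
                 maxn (locality_param n g).2 (locality_param n h).2)
  | FEx _ g => (3 * ((locality_param n g).2.+1 * (locality_param n g).1),
                (locality_param n g).2 + n.+1)
  end.

Lemma locality_param_gt0 n f : 0 < (locality_param n f).1.
Proof. by elim: f => //= [g IHg h _|x g IH]; rewrite ?leq_max ?IHg ?muln_gt0 ?IH. Qed.

(** Quantifiers range over all of [M] whereas moves are bounded; [loc_forth] bridges this gap at the
    price of larger parameters. *)
Lemma loc_sat n f (e e' : nat -> M) : over n f ->
  loc (locality_param n f).1 (locality_param n f).2
      (fun i : 'I_n => e i) (fun i : 'I_n => e' i) ->
  sat e f <-> sat e' f.
Proof.
elim: f e e' => [x y|c|p x|r x y|g IH|g IHg h IHh|x g IH] e e' /=.
- by move=> [xn yn] [[_ H] _]; exact: (H (inl None) (inl (Ordinal xn)) (inl (Ordinal yn))).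
- by [].
- by move=> [[k <-] xn] [[H _] _]; exact: (H (Ordinal xn)).
- move=> [[k <-] xn yn] [[_ H] _].
  exact: (H (inl (Some k)) (inl (Ordinal xn)) (inl (Ordinal yn))).
- by move=> og H; rewrite (IH e e').
- move=> [og oh] H; rewrite (IHg e e') ?(IHh e e') //.
    by apply: loc_mono H; rewrite leq_maxr.
  by apply: loc_mono H; rewrite leq_maxl.
- move=> [xn og] H.
  have step (e1 e2 : nat -> M) : loc (3 * ((locality_param n g).2.+1 * (locality_param n g).1))
      ((locality_param n g).2 + n.+1) (fun i : 'I_n => e1 i) (fun i : 'I_n => e2 i) ->
      (exists a, sat (upd e1 x a) g) -> exists a, sat (upd e2 x a) g.
    rewrite -[in n.+1](card_ord n) => H12 [a Ha].
    have [a' Ha'] := loc_forth a (locality_param_gt0 n g) H12.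
    exists a'; apply/(IH (upd e1 x a)) => //.
    pose f (i : 'I_n) := if i == x :> nat then None else Some i.
    have E (w : nat -> M) b : (fun i : 'I_n => upd w x b i) = ext (fun i : 'I_n => w i) b \o f.
      by apply: funext => i; rewrite /upd /f /=; case: eqP.
    by rewrite !E; apply: loc_reindex.
  by split; apply: step => //; apply: loc_sym.
Qed.

(** * Finiteness of the set of types *)

Definition atom_type R (I : finType) : finType :=
  {ffun (I * KU) + (option KB + 'I_R.+1) * (I + KS) * (I + KS) -> bool}.

Definition atom_tp R (I : finType) (u : I -> M) : atom_type R I :=
  [ffun a => match a with
             | inl (i, p) => `[< urel (us p) (u i) >]
             | inr (b, i, j) => `[< bin b (join u S i) (join u S j) >]
             end].

Lemma atom_tp_eq R (I : finType) (u v : I -> M) :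
  atom_tp R u = atom_tp R v -> atom_eq R u v.
Proof.
move=> /ffunP E; split=> [i p|b i j].
  by have := E (inl (i, p)); rewrite !ffunE => H; split=> /asboolP; [rewrite H|rewrite -H] => /asboolP.
by have := E (inr (b, i, j)); rewrite !ffunE => H; split=> /asboolP; [rewrite H|rewrite -H] => /asboolP.
Qed.

(** As in Hintikka formulas, a type of higher rank records the atomic type and the set of types of
    nearby extensions. This finite type does not mention [M], so one bound serves all structures. *)
Fixpoint tp_type R m (I : finType) : finType :=
  if m is m'.+1 then (atom_type R I * {set I * tp_type R m' (option I)})%type
  else atom_type R I.

Fixpoint tp R m (I : finType) : (I -> M) -> tp_type R m I :=
  match m return (I -> M) -> tp_type R m I with
  | 0 => fun u => atom_tp R u
  | m'.+1 => fun u => (atom_tp R u,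
      [set x : I * tp_type R m' (option I) |
        `[< exists2 z, near R (u x.1) z & tp R m' (ext u z) = x.2 >]])
  end.

Lemma tp_loc R m (I : finType) (u v : I -> M) : tp R m u = tp R m v -> loc R m u v.
Proof.
elim: m I u v => [|m IH] I u v; first by move/atom_tp_eq.
case=> /atom_tp_eq Ea /setP Es; split=> //; split=> i z Hz.
- have := Es (i, tp R m (ext u z)); rewrite !inE.
  have -> : `[< exists2 z0, near R (u i) z0 & tp R m (ext u z0) = tp R m (ext u z) >].
    by apply/asboolP; exists z.
  by move/esym/asboolP => [z' _ Ez']; exists z'; apply: IH.
- have := Es (i, tp R m (ext v z)); rewrite !inE.
  have -> : `[< exists2 z0, near R (v i) z0 & tp R m (ext v z0) = tp R m (ext v z) >].
    by apply/asboolP; exists z.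
  by move/asboolP => [z' _ Ez']; exists z'; apply: IH.
Qed.

End Structure.
End Locality.

(** * Finite parts of the signature, and the conclusion *)

Lemma over_weaken (N U B : Type) (KU KB KU' KB' : finType) (us : KU -> U) (bs : KB -> B)
    (us' : KU' -> U) (bs' : KB' -> B) n n' (f : formula N U B) :
  (forall k, exists k', us' k' = us k) -> (forall k, exists k', bs' k' = bs k) ->
  n <= n' -> over us bs n f -> over us' bs' n' f.
Proof.
move=> Hu Hb nn; elim: f => [x y|c|p x|r x y|g IH|g IHg h IHh|x g IH] //=.
- by case=> xn yn; split; apply: leq_trans nn.
- by case=> -[k <-] xn; split; [apply: Hu | apply: leq_trans nn].
- by case=> -[k <-] xn yn; split; [apply: Hb | apply: leq_trans nn..].
- by case=> /IHg ? /IHh ?.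
- by case=> xn /IH ?; split=> //; apply: leq_trans nn.
Qed.

(** Only finitely many symbols and variables occur in a formula, so the signature itself may be
    infinite. *)
Lemma over_exists (N U B : Type) (f : formula N U B) n0 :
  exists (KU KB : finType) (us : KU -> U) (bs : KB -> B) n, n0 <= n /\ over us bs n f.
Proof.
elim: f => [x y|c|p x|r x y|g IH|g IHg h IHh|x g IH] //=.
- exists void, void, (@of_void U), (@of_void B), (maxn n0 (maxn x y).+1).
  by rewrite leq_maxl !leq_max !ltnS !leq_max !leqnn !orbT.
- by exists void, void, (@of_void U), (@of_void B), n0.
- exists unit, void, (fun _ => p), (@of_void B), (maxn n0 x.+1).
  by rewrite leq_maxl leq_max leqnn orbT; do 2?split=> //; exists tt.
- exists void, unit, (@of_void U), (fun _ => r), (maxn n0 (maxn x y).+1).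
  by rewrite leq_maxl !leq_max !ltnS !leq_max !leqnn !orbT; do 2?split=> //; exists tt.
- case: IHg IHh => KU [KB [us [bs [n [n0n og]]]]] [KU' [KB' [us' [bs' [n' [n0n' oh]]]]]].
  exists (KU + KU')%type, (KB + KB')%type, (join us us'), (join bs bs'), (maxn n n').
  rewrite leq_max n0n; split=> //; split.
    by apply: over_weaken og => [k|k|]; [exists (inl k) | exists (inl k) | apply: leq_maxl].
  by apply: over_weaken oh => [k|k|]; [exists (inr k) | exists (inr k) | apply: leq_maxr].
- case: IH => KU [KB [us [bs [n [n0n og]]]]].
  exists KU, KB, us, bs, (maxn n x.+1); rewrite leq_max n0n; split=> //.
  split; first by rewrite leq_max leqnn orbT.
  by apply: over_weaken og => [k|k|]; [exists k | exists k | apply: leq_maxl].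
Qed.

Theorem theorem4p2 (N U B : Type) (C : cdigraph N U B -> Prop) :
  gaifman_superflat C -> stable C.
Proof.
move=> flat k l phi _ op.
have [KU [KB [us [bs [n [kln ophi]]]]]] := over_exists phi (k + l).
set R := (locality_param n phi).1; set m := (locality_param n phi).2.
have [t Ht] := superflat_scattered n (m.+1 * R) flat.
(* Since [t] is known, so is the number of types over [t] constants; one index more than that forces
   a repetition. *)
have [N0 HN0] := Ht #|tp_type KU KB 'I_t R m 'I_n|.+1.
have [M [a [b [CM Hop]]]] := op N0.
have [p0] := carrier_inh M.
(* The tuples [a i] and [b i] side by side, filled up with [p0] from position [k + l] on. *)
pose c (i : 'I_N0) (v : nat) : M :=
  if v < k then (if insub v is Some x then a i x else p0)
  else (if insub (v - k) is Some y then b i y else p0).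
have [S [J [sS uJ szJ far]]] := HN0 M CM (fun i (v : 'I_n) => c i v).
(* Filling up with [p0] gives exactly [t] constants whatever the size of [S]; every member of [S] is
   among them. *)
pose S' (x : 'I_t) : M := nth p0 S x.
pose nr := @near_avoid {classic M} (@gaifman_rel N U B M) S : nat -> M -> M -> Prop.
have notinS (x : {classic M}) : (forall s, x <> S' s) -> x \notin S.
  move=> H; apply/negP => xS.
  have it : index x S < t by apply: leq_trans sS; rewrite index_mem.
  by apply: (H (Ordinal it)); exact: esym (@nth_index {classic M} p0 x S xS).
have nr_sym : forall r x y, nr r x y -> nr r y x.
  by move=> r x y; apply: near_avoid_sym; apply: gaifman_rel_sym.
have nr_trans : forall r r' x y z, nr r x y -> nr r' y z -> nr (r + r') x z.
  by move=> r r' x y z; apply: near_avoid_trans.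
have nr_mono : forall r r' x y, r <= r' -> nr r x y -> nr r' x y.
  by move=> r r' x y; apply: near_avoid_mono.
have nr_refl : forall x, (forall s, x <> S' s) -> nr 0 x x.
  by move=> x xS; exists [::]; split=> //=; rewrite andbT; apply: notinS.
have nr_brel : forall e x y, brel (bs e) x y ->
    (forall s, x <> S' s) -> (forall s, y <> S' s) -> nr 1 x y.
  (* A loop gives no Gaifman edge, so equal points are handled by [nr_refl]. *)
  move=> e x y xy xS yS; case: (pselect (x = y)) => [<-|ne].
    exact: nr_mono (nr_refl x xS).
  exists [:: y]; split=> //=; last by rewrite !notinS.
  by rewrite andbT; apply/asboolP; split=> //; exists (bs e); left.
have [|tau Htau] := @pigeonhole_count _ _
    (fun i => tp us bs S' nr R m (fun v : 'I_n => c i v)) J 1; first by rewrite szJ muln1.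
have [i [j [iJ jJ ij tij]]] : exists i j, [/\ i \in J, j \in J, i < j &
    loc us bs S' nr R m (fun v : 'I_n => c i v) (fun v : 'I_n => c j v)].
  move: Htau (filter_uniq (fun i => tp us bs S' nr R m (fun v : 'I_n => c i v) == tau) uJ).
  rewrite -size_filter; set J' := [seq _ <- _ | _].
  have HJ' x : x \in J' -> x \in J /\ tp us bs S' nr R m (fun v : 'I_n => c x v) = tau.
    by rewrite mem_filter => /andP[/eqP].
  case: J' HJ' => [|x [|y s]] // HJ' _ /=; rewrite inE negb_or => /andP[/andP[xy _] _].
  have [xJ tx] := HJ' x (mem_head _ _).
  have [yJ ty] : y \in J /\ tp us bs S' nr R m (fun v : 'I_n => c y v) = tau.
    by apply: HJ'; rewrite !inE eqxx orbT.
  case: (ltngtP x y) => [lt|lt|E].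
  - by exists x, y; split=> //; apply: tp_loc; rewrite tx ty.
  - by exists y, x; split=> //; apply: tp_loc; rewrite tx ty.
  - by move: xy; rewrite (val_inj E) eqxx.
pose mix i j v := if v < k then c i v else c j v.
have sat_mix i' j' : sat (mix i' j') phi <-> i' < j'.
  apply: Hop => v; rewrite /mix /c.
    by rewrite ltn_ord; case: insubP => [w _ /val_inj ->|]; rewrite ?ltn_ord.
  rewrite ltnNge leq_addr /= addKn; case: insubP => [w _ /val_inj ->|]; by rewrite ?ltn_ord.
(* As [c i] and [c j] are equivalent and far apart, exchanging [i] and [j] preserves the joined
   tuple up to [loc]; the order property forbids this for [i < j]. *)
have: sat (mix i j) phi <-> sat (mix j i) phi.
  apply: (loc_sat nr_sym nr_trans nr_mono nr_refl nr_brel ophi).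
  pose f (v : 'I_n) : 'I_n + 'I_n := if v < k then inl v else inr v.
  have E i' j' : (fun v : 'I_n => mix i' j' v) =
      join (fun v : 'I_n => c i' v) (fun v : 'I_n => c j' v) \o f.
    by apply: funext => v; rewrite /mix /f /=; case: ifP.
  rewrite !E; apply: loc_reindex.
  have ne : i != j by rewrite -val_eqE neq_ltn ij.
  apply: (loc_join nr_sym nr_trans nr_mono nr_refl nr_brel) => //.
  - exact: locality_param_gt0.
  - exact: loc_sym.
  - by move=> v v'; apply: far.
  - by move=> v v'; apply: far => //; rewrite eq_sym.
by rewrite !sat_mix ij ltnNge (ltnW ij) => -[/(_ isT)].
Qed.
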